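(* Let $A$ be a unitary $*$-algebra of the type $F+J(A)$ over a field $F$ of characteristic zero, generating a variety with quadratic codimension growth. For the multiplicities $m_{((1)_{t^\epsilon})}$ in the proper cocharacters of $A$, we have: (1) $m_{((1)_{0^-})}=1$ if and only if $C_{2,*} \in \mathrm{var}^*(A)$. (2) $m_{((1)_{1^+})}=1$ if and only if $C_2^{gr} \in \mathrm{var}^*(A)$. (3) $m_{((1)_{1^-})}=1$ if and only if $C_{2,*}^{gr} \in \mathrm{var}^*(A)$.
   Context: Throughout, $F$ is a field of characteristic zero and algebras are associative over $F$. A superalgebra is an algebra $A=A_0\oplus A_1$ with $A_iA_j\subseteq A_{i+j}$ (indices mod 2); we also write $A=(A_0,A_1)$. The trivial grading is $(A,0)$. A superinvolution on $A$ is a linear map $*:A\to A$ with $A_i^*\subseteq A_i$, $(a^* )^*=a$ and $(ab)^*=(-1)^{|a||b|}b^*a^*$ for all homogeneous $a,b$. A $*$-algebra is a superalgebra with a superinvolution; it is unitary if it has a unit. Put $A_i^{+}=\{a\in A_i: a^*=a\}$, $A_i^-=\{a\in A_i:a^*=-a\}$. $J(A)$ is the Jacobson radical; ''of the type $F+J(A)$'' means $A=F1_A+J(A)$. Let $\mathcal F$ be the free associative algebra on the disjoint sets $X_i^\varepsilon=\{x_{1,i}^\varepsilon,x_{2,i}^\varepsilon,\dots\}$, $i\in\{0,1\}$, $\varepsilon\in\{+,-\}$, where variables in $X_i^\varepsilon$ have degree $i$ and are symmetric ($\varepsilon=+$) or skew ($\varepsilon=-$). $\mathrm{Id}^*(A)$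 is the set of $f\in\mathcal F$ (the $*$-identities) vanishing under all substitutions sending each $x_{j,i}^\varepsilon$ into $A_i^\varepsilon$, and $\mathrm{var}^*(A)$ is the class of all $*$-algebras $B$ with $\mathrm{Id}^*(A)\subseteq\mathrm{Id}^*(B)$. $P_n^*$ is the span of all $w_{\sigma(1)}\cdots w_{\sigma(n)}$, $\sigma\in S_n$, $w_j\in\{x_{j,0}^+,x_{j,0}^-,x_{j,1}^+,x_{j,1}^-\}$, and $c_n^*(A)=\dim_F P_n^*/(P_n^*\cap \mathrm{Id}^*(A))$. Quadratic codimension growth means $\lim_{n\to\infty}c_n^*(A)/(\alpha n^2)=1$ for some $\alpha\ne0$. A multilinear polynomial is proper if it is a linear combination of products of variables from $X_0^-$, then variables from $X_1^+$, then variables from $X_1^-$, followed by (left-normed) commutators of length at least 2 in arbitrary variables. For $n=n_1+\cdots+n_4$, $\Gamma_{n_1,\dots,n_4}$ is the space of proper multilinear polynomials of degree $n$ in which the first $n_1$ variables are symmetric of degree 0, the next $n_2$ skew of degree 0, the next $n_3$ symmetric of degree 1, the last $n_4$ skew of degree 1. The group $S_{n_1}\times\cdots\times S_{n_4}$ acts by permuting variables of the same type, and the character of $\Gamma_{n_1,\dots,n_4}(A)=\Gamma_{n_1,\dots,n_4}/(\Gamma_{n_1,\dots,n_4}\cap\mathrm{Id}^*(A))$ decomposes as $\pi_{n_1,\dots,n_4}(A)=\sum m_{\lambda_1,\dots,\lambda_4}\,\chi_{\lambda_1}\otimes\cdots\otimes\chi_{\lambda_4}$, summed over $\lambda_i\vdash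 n_i$ (the proper cocharacter of $A$). A multipartition is written $((\lambda_1)_{0^+},(\lambda_2)_{0^-},(\lambda_3)_{1^+},(\lambda_4)_{1^-})$ with empty partitions omitted; e.g. $m_{((1)_{0^-})}$ is the multiplicity for $(n_1,\dots,n_4)=(0,1,0,0)$ and $\lambda_2=(1)$. Algebras: $C_2=\{a(e_{11}+e_{22})+be_{12}: a,b\in F\}$ ($e_{ij}$ matrix units). $C_{2,*}$: trivial grading, superinvolution $b\mapsto -b$. $C_2^{gr}$: grading $(F(e_{11}+e_{22}),Fe_{12})$, identity superinvolution. $C_{2,*}^{gr}$: grading $(F(e_{11}+e_{22}),Fe_{12})$, superinvolution $b\mapsto-b$. *)

(* Defs.v *)
From HB Require Import structures.
From mathcomp Require Import all_boot all_order all_fingroup all_algebra.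
From mathcomp Require Import all_character.
From mathcomp Require Import boolp classical_sets reals topology normedtype.
From mathcomp Require Import sequences.
(* The notations of [monalg] cannot be loaded together with those of
   MathComp-Analysis. *)
From mathcomp Require Import -(notations) monalg.
Import GRing.Theory numFieldNormedType.Exports.
Set Implicit Arguments.
Unset Strict Implicit.
Unset Printing Implicit Defensive.
Local Open Scope classical_set_scope.
Local Open Scope ring_scope.

(* The booleans index Z/2: the component [hcomp i] consists of the elements of
   degree [i], with [false] for 0 and [true] for 1, so that [i (+) j] is the sum
   of the degrees and [i && j] is their product. *)
Record staralg (F : fieldType) (A : algType F) := StarAlg {
  hcomp : bool -> {pred A};
  star : A -> A;
  comp_submod : forall i, submod_closed (hcomp i);
  comp_span : forall a, exists a0 a1,
    [/\ a0 \in hcomp false, a1 \in hcomp true & a = a0 + a1];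
  comp_disjoint : forall a, a \in hcomp false -> a \in hcomp true -> a = 0;
  compM : forall i j a b,
    a \in hcomp i -> b \in hcomp j -> a * b \in hcomp (i (+) j);
  star_linear : linear star;
  star_comp : forall i a, a \in hcomp i -> star a \in hcomp i;
  starK : involutive star;
  starM : forall i j a b, a \in hcomp i -> b \in hcomp j ->
    star (a * b) = (-1) ^+ (i && j) *: (star b * star a) }.

(* A pair (degree, parity), where the parity is [false] for symmetric and [true]
   for skew elements. *)
Notation vsort := (bool * bool)%type.
Notation sort0p := (false, false).
Notation sort0m := (false, true).
Notation sort1p := (true, false).
Notation sort1m := (true, true).

Definition homog (F : fieldType) (A : algType F) (S : staralg A) (t : vsort)
    : set A :=
  [set a | a \in hcomp S t.1 /\ star S a = (-1) ^+ t.2 *: a].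

(* The variable [(t, j)] is the [j]-th variable of sort [t]; indices start at
   0. *)
Notation var := (vsort * nat)%type.

(* The free associative unital algebra on the variables. *)
Notation freealg F := (malg (fmonom var) F).

Definition varp (F : fieldType) (x : var) : freealg F := mkmalgU (fmu x) 1.

Definition evalp (F : fieldType) (B : lalgType F) (v : var -> B)
    (f : freealg F) : B :=
  mmap (in_alg B) (fun w : fmonom var => \prod_(x <- w) v x) f.

Definition Idstar (F : fieldType) (A : algType F) (S : staralg A)
    : set (freealg F) :=
  [set f | forall v : var -> A,
     (forall x, homog S x.1 (v x)) -> evalp v f = 0].

(* [in_varstar SA SB]: the *-algebra [SB] belongs to the variety generated by
   [SA]. *)
Definition in_varstar (F : fieldType) (A B : algType F)
    (SA : staralg A) (SB : staralg B) : Prop :=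
  Idstar SA `<=` Idstar SB.

Definition lin_span (F : fieldType) (V : lmodType F) (X : set V) : set V :=
  [set v | exists (d : nat) (c : 'I_d -> F) (x : 'I_d -> V),
     (forall i, X (x i)) /\ v = \sum_i c i *: x i].

(* [s] is a family of elements of the subspace [P] inducing a basis of the
   quotient of [P] by its intersection with the subspace [I]. *)
Definition quot_basis (F : fieldType) (V : lmodType F) (P I : set V)
    (d : nat) (s : 'I_d -> V) : Prop :=
  [/\ forall i, P (s i),
      forall c : 'I_d -> F, I (\sum_i c i *: s i) -> forall i, c i = 0
    & forall v, P v -> exists c : 'I_d -> F, I (v - \sum_i c i *: s i)].

Definition quot_dim (F : fieldType) (V : lmodType F) (P I : set V) : nat :=
  xget 0%N [set d | exists s : 'I_d -> V, quot_basis P I s].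

Definition Pstar (F : fieldType) (n : nat) : set (freealg F) :=
  lin_span [set f | exists (sigma : 'S_n) (t : 'I_n -> vsort),
    f = \prod_(i < n) varp F (t (sigma i), val (sigma i))].

Definition codim (F : fieldType) (A : algType F) (S : staralg A) (n : nat)
    : nat :=
  quot_dim (@Pstar F n) (Idstar S).

Definition quadratic_growth (R : realType) (F : fieldType) (A : algType F)
    (S : staralg A) : Prop :=
  exists alpha : R, alpha != 0 /\
    (fun n => (codim S n)%:R / (alpha * n%:R ^+ 2)) @ \oo --> (1 : R).

Definition maximal_left_ideal (A : nzRingType) (M : {pred A}) : Prop :=
  idealr_closed M /\
  forall N : {pred A}, idealr_closed N -> {subset M <= N} -> {subset N <= M}.

Definition jacobson (A : nzRingType) : set A :=
  [set a | forall M : {pred A}, maximal_left_ideal M -> a \in M].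

Definition F_plus_J (F : fieldType) (A : algType F) : Prop :=
  forall a : A, exists c : F, exists2 j : A, jacobson j & a = c%:A + j.

(* Left-normed commutators. *)
Definition lcomm (F : fieldType) (s : seq var) : freealg F :=
  if s is x :: s' then
    foldl (fun a y => a * varp F y - varp F y * a) (varp F x) s'
  else 0.

Definition proper_product (F : fieldType) : set (freealg F) :=
  [set f | exists (u2 u3 u4 : seq var) (cs : seq (seq var)),
     [/\ all (fun x => x.1 == sort0m) u2,
         all (fun x => x.1 == sort1p) u3,
         all (fun x => x.1 == sort1m) u4,
         all (fun c => 2 <= size c)%N cs
       & f = \prod_(x <- u2) varp F x * \prod_(x <- u3) varp F x
             * \prod_(x <- u4) varp F x * \prod_(c <- cs) lcomm F c]].

Definition multilinear_in (F : fieldType) (xs : seq var) : set (freealg F) :=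
  lin_span [set f | exists2 w : seq var,
    perm_eq w xs & f = \prod_(x <- w) varp F x].

(* The sorts are taken consecutively: the indices of the variables of the
   second sort start at [n1], and so on. *)
Definition gvars (n1 n2 n3 n4 : nat) : seq var :=
  [seq (sort0p, k) | k <- iota 0 n1]
  ++ [seq (sort0m, k) | k <- iota n1 n2]
  ++ [seq (sort1p, k) | k <- iota (n1 + n2) n3]
  ++ [seq (sort1m, k) | k <- iota (n1 + n2 + n3) n4].

Definition Gamma (F : fieldType) (n1 n2 n3 n4 : nat) : set (freealg F) :=
  @multilinear_in F (gvars n1 n2 n3 n4) `&` lin_span (@proper_product F).

Notation perm4 n1 n2 n3 n4 := ('S_n1 * 'S_n2 * 'S_n3 * 'S_n4)%type.

(* The permutation [g] transported to the interval of length [n] starting at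
   [m], and extended by the identity. *)
Definition block_perm (m n : nat) (g : 'S_n) (k : nat) : nat :=
  if (m <= k)%N then
    if insub (k - m)%N is Some i then (m + g i)%N else k
  else k.

Definition perm_var (n1 n2 n3 n4 : nat) (g : perm4 n1 n2 n3 n4) (x : var)
    : var :=
  match x with
  | (sort0p, k) => (sort0p, block_perm 0 g.1.1.1 k)
  | (sort0m, k) => (sort0m, block_perm n1 g.1.1.2 k)
  | (sort1p, k) => (sort1p, block_perm (n1 + n2) g.1.2 k)
  | (sort1m, k) => (sort1m, block_perm (n1 + n2 + n3) g.2 k)
  end.

Definition act_var (F : fieldType) (n1 n2 n3 n4 : nat)
    (g : perm4 n1 n2 n3 n4) (f : freealg F) : freealg F :=
  evalp (fun x => varp F (perm_var g x)) f.

(* [rG] is the representation on the proper multilinear polynomials modulo the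
   *-identities, written in some basis. In MathComp, permutations compose from
   left to right and representations act on row vectors from the right. *)
Definition affords_Gamma (F : fieldType) (A : algType F) (S : staralg A)
    (n1 n2 n3 n4 d : nat)
    (rG : mx_representation F [set: perm4 n1 n2 n3 n4]%G d) : Prop :=
  exists2 s : 'I_d -> freealg F,
    quot_basis (@Gamma F n1 n2 n3 n4) (Idstar S) s &
    forall g i, Idstar S (act_var g (s i) - \sum_j rG g i j *: s j).

(* Partitions of [n], padded with zeros to length [n]. *)
Notation partn n :=
  {t : n.-tuple 'I_n.+1 |
    sorted geq (map val t) && (sumn (map val t) == n)}.

Definition parts (n : nat) (la : partn n) : seq nat := map val (val la).

Definition partn_nil : partn 0 := exist _ [tuple] isT.
Definition partn_one : partn 1 := exist _ [tuple ord_max] isT.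

(* The Young tableau of shape [la] filled row by row with 0, ..., n - 1 has
   the entry [k] in row [reshape_index (parts la) k] and in column
   [reshape_offset (parts la) k]. *)
Definition row_stab (n : nat) (la : partn n) : {set 'S_n} :=
  [set p : 'S_n | [forall k : 'I_n,
    reshape_index (parts la) (p k) == reshape_index (parts la) k]].

Definition col_stab (n : nat) (la : partn n) : {set 'S_n} :=
  [set q : 'S_n | [forall k : 'I_n,
    reshape_offset (parts la) (q k) == reshape_offset (parts la) k]].

(* The Young symmetrizer, as a row vector in the regular representation. *)
Definition young_sym (F : fieldType) (n : nat) (la : partn n)
    : 'rV[F]_#|[set: 'S_n]%G| :=
  \sum_(p in row_stab la) \sum_(q in col_stab la)
    (-1) ^+ (odd_perm q) *: delta_mx 0 (gring_index [set: 'S_n]%G (p * q)%g).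

(* The irreducible character of the symmetric group attached to [la], afforded
   by the ideal of the group algebra generated by the Young symmetrizer. *)
Definition irr_char (F : fieldType) (n : nat) (la : partn n) (g : 'S_n) : F :=
  \tr (submod_repr (cyclic_mx_module (regular_repr F [set: 'S_n]%G)
                                     (young_sym F la)) g).

Notation partn4 n1 n2 n3 n4 :=
  (partn n1 * partn n2 * partn n3 * partn n4)%type.

Definition irr_char4 (F : fieldType) (n1 n2 n3 n4 : nat)
    (la : partn4 n1 n2 n3 n4) (g : perm4 n1 n2 n3 n4) : F :=
  irr_char F la.1.1.1 g.1.1.1 * irr_char F la.1.1.2 g.1.1.2
  * irr_char F la.1.2 g.1.2 * irr_char F la.2 g.2.

Definition proper_mults (F : fieldType) (A : algType F) (S : staralg A)
    (n1 n2 n3 n4 : nat) : set {ffun partn4 n1 n2 n3 n4 -> nat} :=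
  [set m | exists (d : nat)
      (rG : mx_representation F [set: perm4 n1 n2 n3 n4]%G d),
    affords_Gamma S rG /\
    forall g, \tr (rG g) = \sum_la (m la)%:R * irr_char4 F la g].

(* The multiplicities in the proper cocharacter; they are uniquely determined,
   as the irreducible characters are linearly independent in characteristic
   zero. *)
Definition proper_mult (F : fieldType) (A : algType F) (S : staralg A)
    (n1 n2 n3 n4 : nat) (la : partn4 n1 n2 n3 n4) : nat :=
  xget [ffun=> 0%N] (@proper_mults F A S n1 n2 n3 n4) la.

Definition C2_mx (F : fieldType) (a b : F) : 'M[F]_2 :=
  a *: 1 + b *: delta_mx 0 1.

Definition C2_pred (F : fieldType) : {pred 'M[F]_2} :=
  [pred M : 'M[F]_2 | M == C2_mx (M 0 0) (M 0 1)].
Arguments C2_pred : clear implicits.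

Lemma C2_mx00 (F : fieldType) (a b : F) : C2_mx a b 0 0 = a.
Proof. by rewrite !mxE /= mulr1 mulr0 addr0. Qed.

Lemma C2_mx01 (F : fieldType) (a b : F) : C2_mx a b 0 1 = b.
Proof. by rewrite !mxE /= mulr1 mulr0 add0r. Qed.

Lemma C2_mx_in (F : fieldType) (a b : F) : C2_mx a b \in C2_pred F.
Proof. by rewrite inE C2_mx00 C2_mx01. Qed.

Lemma C2_predP (F : fieldType) (M : 'M[F]_2) :
  reflect (M = C2_mx (M 0 0) (M 0 1)) (M \in C2_pred F).
Proof. by rewrite inE; exact: eqP. Qed.

Lemma C2_mx1 (F : fieldType) : 1 = C2_mx 1 0 :> 'M[F]_2.
Proof. by rewrite /C2_mx scale0r addr0 scale1r. Qed.

Lemma C2_mxL (F : fieldType) (k a b c d : F) :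
  k *: C2_mx a b + C2_mx c d = C2_mx (k * a + c) (k * b + d).
Proof. by rewrite /C2_mx scalerDr !scalerA !scalerDl addrACA. Qed.

Lemma C2_mxM (F : fieldType) (a b c d : F) :
  C2_mx a b * C2_mx c d = C2_mx (a * c) (a * d + b * c).
Proof.
have ee : delta_mx 0 1 * delta_mx 0 1 = 0 :> 'M[F]_2.
  exact: mul_delta_mx_0.
rewrite /C2_mx mulrDl !mulrDr -!scalerAl -!scalerAr !mul1r mulr1 ee.
by rewrite !scaler0 addr0 !scalerA scalerDl addrA.
Qed.

Lemma C2_subalg (F : fieldType) : subalg_closed (C2_pred F).
Proof.
split.
- by rewrite C2_mx1 C2_mx_in.
- by move=> k M N /C2_predP -> /C2_predP ->; rewrite C2_mxL C2_mx_in.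
- by move=> M N /C2_predP -> /C2_predP ->; rewrite C2_mxM C2_mx_in.
Qed.

HB.instance Definition _ (F : fieldType) :=
  GRing.isSubalgClosed.Build F 'M[F]_2 (C2_pred F)
    (GRing.subalg_closed_semi (C2_subalg F)).

Record C2 (F : fieldType) :=
  MkC2 { C2_val : 'M[F]_2; _ : C2_val \in C2_pred F }.

HB.instance Definition _ (F : fieldType) := [isSub for @C2_val F].
HB.instance Definition _ (F : fieldType) := [Choice of C2 F by <:].
HB.instance Definition _ (F : fieldType) :=
  [SubChoice_isSubAlgebra of C2 F by <:].

Definition C2_of (F : fieldType) (a b : F) : C2 F := MkC2 (C2_mx_in a b).
Definition C2_a (F : fieldType) (u : C2 F) : F := C2_val u 0 0.
Definition C2_b (F : fieldType) (u : C2 F) : F := C2_val u 0 1.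

Lemma C2_of_a (F : fieldType) (a b : F) : C2_a (C2_of a b) = a.
Proof. exact: C2_mx00. Qed.

Lemma C2_of_b (F : fieldType) (a b : F) : C2_b (C2_of a b) = b.
Proof. exact: C2_mx01. Qed.

Lemma C2_eta (F : fieldType) (u : C2 F) : u = C2_of (C2_a u) (C2_b u).
Proof. by apply: val_inj; exact/C2_predP/(valP u). Qed.

Lemma C2_ofL (F : fieldType) (k a b c d : F) :
  k *: C2_of a b + C2_of c d = C2_of (k * a + c) (k * b + d).
Proof. by apply: val_inj; rewrite /= C2_mxL. Qed.

Lemma C2_ofM (F : fieldType) (a b c d : F) :
  C2_of a b * C2_of c d = C2_of (a * c) (a * d + b * c).
Proof. by apply: val_inj; rewrite /= C2_mxM. Qed.

Lemma C2_of0 (F : fieldType) : 0 = C2_of 0 0 :> C2 F.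
Proof. by apply: val_inj; rewrite /= /C2_mx !scale0r addr0. Qed.

(* The trivial grading for [gr = false], and the grading with the multiples of
   [e_12] in degree 1 for [gr = true]. *)
Definition C2_comp (F : fieldType) (gr : bool) (i : bool) : {pred C2 F} :=
  [pred u | if gr then (if i then C2_a u == 0 else C2_b u == 0)
            else i ==> (u == 0)].

(* The identity for [sk = false], and the change of sign of the coefficient of
   [e_12] for [sk = true]. *)
Definition C2_inv (F : fieldType) (sk : bool) (u : C2 F) : C2 F :=
  C2_of (C2_a u) ((-1) ^+ sk * C2_b u).

Section C2Star.
Context (F : fieldType) (gr sk : bool).
Let C2E := (C2_ofL, C2_ofM, C2_of_a, C2_of_b).

Lemma C2_aL (k : F) u w : C2_a (k *: u + w) = k * C2_a u + C2_a w.
Proof. by rewrite (C2_eta u) (C2_eta w) !C2E. Qed.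
Lemma C2_bL (k : F) u w : C2_b (k *: u + w) = k * C2_b u + C2_b w.
Proof. by rewrite (C2_eta u) (C2_eta w) !C2E. Qed.
Lemma C2_a0 : C2_a (0 : C2 F) = 0. Proof. by rewrite C2_of0 C2_of_a. Qed.
Lemma C2_b0 : C2_b (0 : C2 F) = 0. Proof. by rewrite C2_of0 C2_of_b. Qed.

Lemma C2_comp_submod i : submod_closed (@C2_comp F gr i).
Proof.
split=> [|k u w]; rewrite !inE.
  by case: gr; rewrite ?C2_a0 ?C2_b0 eqxx ?implybT //; case: i.
case: gr; case: i => //=; rewrite ?C2_aL ?C2_bL.
- by move=> /eqP-> /eqP->; rewrite mulr0 addr0.
- by move=> /eqP-> /eqP->; rewrite mulr0 addr0.
- by move=> /eqP-> /eqP->; rewrite scaler0 addr0.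
Qed.

Lemma C2_comp_span (u : C2 F) : exists a0 a1,
  [/\ a0 \in C2_comp gr false, a1 \in C2_comp gr true & u = a0 + a1].
Proof.
case: gr.
  exists (C2_of (C2_a u) 0), (C2_of 0 (C2_b u)).
  rewrite !inE /= !C2E !eqxx; split=> //.
  by rewrite -[C2_of _ 0]scale1r C2_ofL !mul1r addr0 add0r -C2_eta.
by exists u, 0; rewrite !inE /= eqxx addr0.
Qed.

Lemma C2_comp_disjoint (u : C2 F) :
  u \in C2_comp gr false -> u \in C2_comp gr true -> u = 0.
Proof.
rewrite !inE; case: gr => /=; last by move=> _ /eqP.
by move=> /eqP b0 /eqP a0; rewrite [u]C2_eta a0 b0 -C2_of0.
Qed.

Lemma C2_compM i j (u w : C2 F) :
  u \in C2_comp gr i -> w \in C2_comp gr j -> u * w \in C2_comp gr (i (+) j).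
Proof.
rewrite !inE; case: gr => /=.
  have -> : u * w = C2_of (C2_a u * C2_a w) (C2_a u * C2_b w + C2_b u * C2_a w).
    by rewrite {1}(C2_eta u) {1}(C2_eta w) C2_ofM.
  rewrite !C2E; case: i; case: j => /= /eqP u0 /eqP w0;
    by rewrite ?u0 ?w0 ?(mul0r, mulr0, addr0).
case: i => /=; first by move=> /eqP->; rewrite mul0r eqxx implybT.
by case: j => //= _ /eqP->; rewrite mulr0.
Qed.

Lemma C2_inv_linear : linear (@C2_inv F sk).
Proof.
move=> k u w; rewrite /C2_inv C2_aL C2_bL C2_ofL.
by rewrite mulrDr (mulrCA _ k).
Qed.

Lemma C2_inv_comp i (u : C2 F) :
  u \in C2_comp gr i -> C2_inv sk u \in C2_comp gr i.
Proof.
rewrite !inE /C2_inv !C2E; case: gr; case: i => //= /eqP->.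
- by rewrite mulr0.
- by rewrite C2_a0 C2_b0 mulr0 -C2_of0.
Qed.

Lemma C2_invK : involutive (@C2_inv F sk).
Proof.
by move=> u; rewrite /C2_inv !C2E mulrA -signr_addb addbb mul1r -C2_eta.
Qed.

Lemma C2_invM i j (u w : C2 F) :
  u \in C2_comp gr i -> w \in C2_comp gr j ->
  C2_inv sk (u * w) = (-1) ^+ (i && j) *: (C2_inv sk w * C2_inv sk u).
Proof.
have E : C2_inv sk (u * w) = C2_inv sk w * C2_inv sk u.
  rewrite {1}(C2_eta u) {1}(C2_eta w) /C2_inv !C2E; congr C2_of.
    by rewrite mulrC.
  by rewrite (mulrC (C2_a w)) (mulrC (C2_a u)) -!mulrA mulrDr addrC.
rewrite E; case ij: (i && j); last by rewrite scale1r.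
case/andP: ij => -> ->; rewrite !inE; case: gr => /= /eqP u0 /eqP w0.
  rewrite /C2_inv u0 w0 C2_ofM !mul0r mulr0 addr0 -C2_of0; exact/esym/scaler0.
by rewrite u0 w0 /C2_inv C2_a0 C2_b0 mulr0 -C2_of0 mulr0 scaler0.
Qed.

Definition C2_staralg : staralg (C2 F) :=
  StarAlg C2_comp_submod C2_comp_span C2_comp_disjoint C2_compM
    C2_inv_linear C2_inv_comp C2_invK C2_invM.

End C2Star.

Definition C2_skew (F : fieldType) : staralg (C2 F) := C2_staralg F false true.
Definition C2_gr (F : fieldType) : staralg (C2 F) := C2_staralg F true false.
Definition C2_gr_skew (F : fieldType) : staralg (C2 F) :=
  C2_staralg F true true.

(* Main.v *)
(* For each of the three sorts t, both sides say that A has a nonzero element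
   of sort t.  The space of proper polynomials in one variable x of sort t is
   spanned by x, which gives the multiplicity.  For the varieties, C2 with the
   matching structure is generated by a unit and an element e of sort t with
   e^2 = 0, all other sorts being zero; substituting scalars and multiples of
   an indeterminate X for the variables turns a polynomial f into p in F[X],
   whose value at e depends only on its coefficients of degree 0 and 1.  If f is
   an identity of A and a is a nonzero element of sort t in A, then p(l a) = 0
   for all scalars l, and as F is infinite these two coefficients vanish. *)
From mathcomp Require Import all_boot all_fingroup all_algebra.
From mathcomp Require Import all_character.
From mathcomp Require Import boolp classical_sets reals.
From mathcomp Require Import -(notations) monalg.
Require Import Defs.
Import GRing.Theory.
Set Implicit Arguments.
Unset Strict Implicit.
Unset Printing Implicit Defensive.
Local Open Scope ring_scope.

(** * Consequences of characteristic zero *)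

Section CharacteristicZero.
Variables (F : fieldType) (hF : [pchar F] =i pred0).

Lemma natf_eq0 (n : nat) : (n%:R == 0 :> F) = (n == 0)%N.
Proof. exact: (iffLR (pcharf0P F) hF). Qed.

Lemma natf_inj : injective (fun n => n%:R : F).
Proof.
move=> m n; wlog le_mn : m n / (m <= n)%N => [W|/eqP].
  by case/orP: (leq_total m n) => [/W//|/W W' /esym/W'].
rewrite eq_sym -subr_eq0 -natrB // natf_eq0 subn_eq0 => le_nm.
by apply/eqP; rewrite eqn_leq le_mn.
Qed.

Lemma eq_opp0 (V : lmodType F) (v : V) : v = - v -> v = 0.
Proof.
move=> /eqP; rewrite -subr_eq0 opprK -mulr2n -scaler_nat scaler_eq0.
by rewrite natf_eq0 => /eqP.
Qed.

(* Comparing the values at [l] and [2 l] eliminates the top coefficient. *)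
Lemma vanishing_coefs (V : lmodType F) (n : nat) (w : nat -> V) :
    (forall l : F, \sum_(i < n) l ^+ i *: w i = 0) ->
  forall i, (i < n)%N -> w i = 0.
Proof.
elim: n w => [//|n IH] w w0.
have low i : (i < n)%N -> w i = 0.
  move=> lt_in; have /eqP : (2%:R ^+ i - 2%:R ^+ n : F) *: w i = 0.
    apply: (IH (fun i => (2%:R ^+ i - 2%:R ^+ n : F) *: w i)) => // l.
    under eq_bigr do rewrite scalerA mulrBr scalerBl (mulrC _ (2%:R ^+ n))
      -[in X in _ - X]scalerA mulrC -exprMn.
    rewrite sumrB -scaler_sumr.
    have := w0 (2%:R * l); rewrite big_ord_recr => /eqP.
    rewrite addr_eq0 => /eqP->.
    have := w0 l; rewrite big_ord_recr => /eqP.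
    by rewrite addr_eq0 => /eqP->; rewrite exprMn scalerN opprK scalerA addNr.
  (* In characteristic zero the powers [2 ^ i] and [2 ^ n] differ for [i < n], so the factor
     cancels. *)
  rewrite scaler_eq0 subr_eq0 -!natrX => /orP[/eqP/natf_inj/eqP|/eqP//].
  by rewrite eqn_exp2l // ltn_eqF.
move=> i; rewrite ltnS leq_eqVlt => /orP[/eqP->|/low//].
have := w0 1; rewrite big_ord_recr /= big1 ?add0r ?expr1n ?scale1r // => j _.
by rewrite low ?scaler0.
Qed.

End CharacteristicZero.

(** * Evaluation of noncommutative polynomials *)

Section Evaluation.
Variable F : fieldType.

Lemma horner_algE (B : algType F) (b : B) (p : {poly F}) :
  horner_alg b p = \sum_(i < size p) p`_i *: b ^+ i.
Proof.
rewrite {1}(_ : p = \sum_(i < size p) p`_i *: 'X^i); last first.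
  by rewrite -poly_def coefK.
rewrite raddf_sum; apply: eq_bigr => i _.
by rewrite /= linearZ /= rmorphXn /= horner_algX mulr_algl.
Qed.

Lemma evalp_varp (B : lalgType F) (v : var -> B) x : evalp v (varp F x) = v x.
Proof. by rewrite /evalp /varp mmapU fmuE big_seq1 /= scale1r mul1r. Qed.

Lemma evalpZ (B : lalgType F) (v : var -> B) k (f : freealg F) :
  evalp v (k *: f) = k *: evalp v f.
Proof.
rewrite /evalp (mmapEw (msuppZ_le _ _)) mmapE scaler_sumr.
by apply: eq_bigr => w _; rewrite mcoeffZ /= -!scalerAl !mul1r scalerA.
Qed.

(** Evaluation at [b] is an algebra morphism from F[X] to [B], so it commutes with substitution into
    [f]. One polynomial in F[X] can thus be compared at elements of different algebras. *)
Lemma horner_alg_evalp (B : algType F) (b : B) (v : var -> {poly F})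
    (f : freealg F) :
  horner_alg b (evalp v f) = evalp (horner_alg b \o v) f.
Proof.
rewrite /evalp !mmapE raddf_sum; apply: eq_bigr => w _.
by rewrite /= !mulr_algl linearZ /= mulr_algl rmorph_prod.
Qed.

Lemma eq_evalp (B : lalgType F) (v w : var -> B) :
  v =1 w -> evalp v =1 evalp w.
Proof. by move=> /funext->. Qed.

End Evaluation.

(** * Homogeneous elements of a superalgebra with superinvolution, and its unit *)

Section Homogeneous.
Variables (F : fieldType) (A : algType F) (S : staralg A).

Lemma hcomp0 i : 0 \in hcomp S i.
Proof. by case: (comp_submod S i). Qed.

Lemma hcompL i k a b : a \in hcomp S i -> b \in hcomp S i ->
  k *: a + b \in hcomp S i.
Proof. by case: (comp_submod S i) => _; apply. Qed.

Lemma hcompZ i k a : a \in hcomp S i -> k *: a \in hcomp S i.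
Proof. by move=> ha; rewrite -[_ *: _]addr0 hcompL ?hcomp0. Qed.

Lemma hcompB i a b : a \in hcomp S i -> b \in hcomp S i -> a - b \in hcomp S i.
Proof. by move=> ha hb; rewrite addrC -scaleN1r hcompL. Qed.

Lemma starZ k a : star S (k *: a) = k *: star S a.
Proof.
have L := star_linear S.
have s0 : star S 0 = 0.
  by have := L (-1) 0 0; rewrite scaler0 addr0 scaleN1r addNr.
by have := L k a 0; rewrite s0 !addr0.
Qed.

Lemma homogZ t k a : homog S t a -> homog S t (k *: a).
Proof.
by move=> [ha sa]; split; rewrite ?hcompZ // starZ sa !scalerA mulrC.
Qed.

Lemma homog0 t : homog S t 0.
Proof.
split; first exact: hcomp0.
by rewrite scaler0 -[X in star S X](scale0r (0 : A)) starZ scale0r.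
Qed.

(** Write [1 = e0 + e1]. For [b] of degree [i], the product [b * e1 = b - b * e0] has both degree
    [i] and degree [i + 1], hence vanishes. So every [c] kills [e1], in particular [c = 1]. *)
Lemma hcomp_1 : 1 \in hcomp S false.
Proof.
have [e0 [e1 [h0 h1 e]]] := comp_span S 1.
suff kill c : c * e1 = 0 by rewrite e -[e1]mul1r kill addr0.
have hom i b : b \in hcomp S i -> b * e1 = 0.
  move=> hb; have be1 : b * e1 = b - b * e0.
    by rewrite -[X in X - _]mulr1 e mulrDr addrC addKr.
  have hb1 : b * e1 \in hcomp S (~~ i).
    by have := compM hb h1; rewrite addbT.
  have hb0 : b * e1 \in hcomp S i.
    by rewrite be1 hcompB //; have := compM hb h0; rewrite addbF.
  by case: i {hb} hb0 hb1 => h h';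
    [exact: comp_disjoint h' h | exact: comp_disjoint h h'].
have [c0 [c1 [/hom z0 /hom z1 ->]]] := comp_span S c.
by rewrite mulrDl z0 z1 addr0.
Qed.

Lemma homog_1 : homog S sort0p 1.
Proof.
split; first exact: hcomp_1.
(* In [star (1 * star 1) = star (star 1) * star 1] the left side is 1 and the right side is
   [star 1]. *)
have /= := starM hcomp_1 (star_comp hcomp_1).
by rewrite mul1r starK mul1r expr0 scale1r => <-; rewrite scale1r.
Qed.

End Homogeneous.

(** * Membership of the algebras on [C2] in a variety *)

Section C2Variety.
Variables (F : fieldType) (hF : [pchar F] =i pred0).

Lemma C2_of_eq0 (a b : F) : C2_of a b = 0 -> a = 0 /\ b = 0.
Proof.
move=> e; split; first by rewrite -(C2_of_a a b) e C2_a0.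
by rewrite -(C2_of_b a b) e C2_b0.
Qed.

Lemma C2_ofE (a b : F) : C2_of a b = a%:A + b *: C2_of 0 1.
Proof.
have -> : 1 = C2_of 1 0 :> C2 F by apply: val_inj; rewrite /= C2_mx1.
rewrite -[b *: _]addr0 C2_of0 !C2_ofL.
by rewrite !mulr0 !mulr1 !addr0 add0r.
Qed.

Lemma C2_of01_sqr : C2_of 0 1 * C2_of 0 1 = 0 :> C2 F.
Proof. by rewrite C2_ofM !mulr0 !mul0r addr0 -C2_of0. Qed.

Lemma homog_C2_of01 gr sk : homog (C2_staralg F gr sk) (gr, sk) (C2_of 0 1).
Proof.
split; first by rewrite !inE /=; case: gr; rewrite ?C2_of_a ?eqxx.
rewrite /= /C2_inv C2_of_a C2_of_b mulr1.
by rewrite -[RHS]addr0 C2_of0 C2_ofL mulr0 !addr0 mulr1.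
Qed.

(** The unit has sort [sort0p] and e_12 has sort [(gr, sk)]. A coordinate of the wrong degree
    vanishes by the grading, one of the wrong parity because it equals its opposite. *)
Lemma homog_C2 gr sk t u : (gr, sk) != sort0p ->
    homog (C2_staralg F gr sk) t u ->
  u = C2_of (if t == sort0p then C2_a u else 0)
            (if t == (gr, sk) then C2_b u else 0).
Proof.
case: t => i e ne [] /=; rewrite inE /= /C2_inv => hu su.
have {su}[sa sb] : C2_a u = (-1) ^+ e * C2_a u
    /\ (-1) ^+ sk * C2_b u = (-1) ^+ e * C2_b u.
  rewrite -[in RHS](addr0 ((-1) ^+ e *: u)) in su.
  split.
    by have := congr1 (@C2_a F) su; rewrite C2_of_a C2_aL C2_a0 addr0.
  by have := congr1 (@C2_b F) su; rewrite C2_of_b C2_bL C2_b0 addr0.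
have z (x : F) : x = - x -> x = 0 by exact: (eq_opp0 hF (V := F^o)).
rewrite [LHS]C2_eta.
case: gr sk i e ne hu sa sb => [] [] [] [] //= _;
  rewrite ?expr0 ?expr1 ?mulN1r ?mul1r => /eqP hu sa sb;
  rewrite ?hu ?C2_a0 ?C2_b0 //;
  try rewrite (z _ sa) //; try rewrite (z _ sb) //;
  try rewrite (z _ (esym sb)) //.
Qed.

Lemma in_varstar_C2 (A : algType F) (S : staralg A) gr sk (a : A) :
    (gr, sk) != sort0p -> homog S (gr, sk) a -> a != 0 ->
  in_varstar S (C2_staralg F gr sk).
Proof.
move=> ne ha a0 f fA v hv.
(* A lift of [v] to F[X]: setting X to e_12 recovers [v], and setting X to [l *: a] gives an
   admissible substitution in [A]. *)
pose vp (x : var) : {poly F} :=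
  if x.1 == sort0p then (C2_a (v x))%:P
  else if x.1 == (gr, sk) then C2_b (v x) *: 'X else 0.
have hvp (B : algType F) (b : B) x : horner_alg b (vp x) =
    if x.1 == sort0p then (C2_a (v x))%:A
    else if x.1 == (gr, sk) then C2_b (v x) *: b else 0.
  rewrite /vp; case: ifP => _; first by rewrite horner_algC.
  by case: ifP => _; rewrite ?raddf0 // linearZ /= mulr_algl horner_algX.
pose p := evalp vp f.
have pa l : \sum_(i < size p) l ^+ i *: (p`_i *: a ^+ i) = 0.
  have e : horner_alg (l *: a) p = 0.
    rewrite /p horner_alg_evalp; apply: fA => x; rewrite /= hvp.
    case: ifP => [/eqP->|_]; first exact/homogZ/homog_1.
    by case: ifP => [/eqP->|_]; [do 2 apply: homogZ | exact: homog0].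
  rewrite -[RHS]e horner_algE; apply: eq_bigr => i _.
  by rewrite exprZn !scalerA mulrC.
have pi0 i : p`_i *: a ^+ i = 0.
  have [lt_i|ge_i] := ltnP i (size p); last by rewrite nth_default ?scale0r.
  exact: (vanishing_coefs hF (w := fun i => p`_i *: a ^+ i) pa lt_i).
(* The first two powers of [a] are 1 and [a], both nonzero, so their coefficients must vanish. *)
have p0 : p`_0 = 0.
  by apply/eqP; have /eqP := pi0 0%N; rewrite scaler_eq0 oner_eq0 orbF.
have p1 : p`_1 = 0.
  by apply/eqP; have /eqP := pi0 1%N; rewrite scaler_eq0 (negPf a0) orbF.
rewrite (@eq_evalp _ _ v (horner_alg (C2_of 0 1) \o vp)) => [|x].
  rewrite -horner_alg_evalp horner_algE big1 // => -[[|[|i]] _] _ /=.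
  - by rewrite p0 scale0r.
  - by rewrite p1 scale0r.
  by rewrite !exprS mulrA C2_of01_sqr mul0r scaler0.
rewrite /= hvp [LHS](homog_C2 ne (hv x)) C2_ofE.
case: ifP => [/eqP->|_]; first by rewrite eq_sym (negPf ne) scale0r addr0.
by case: ifP => _; rewrite ?scale0r ?addr0 ?add0r.
Qed.

(** Otherwise a single variable of sort [(gr, sk)] would be an identity of [A], but it takes the
    nonzero value e_12 on [C2]. *)
Lemma in_varstar_C2_homog (A : algType F) (S : staralg A) gr sk :
    in_varstar S (C2_staralg F gr sk) ->
  exists2 a, homog S (gr, sk) a & a != 0.
Proof.
move=> var_C2; apply: contrapT => noA.
have /var_C2 /(_ (fun x => if x.1 == (gr, sk) then C2_of 0 1 else 0)) :
    Idstar S (varp F ((gr, sk), 0%N)).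
  move=> v hv; rewrite evalp_varp; apply: contrapT => /eqP v0.
  by apply: noA; exists (v ((gr, sk), 0%N)) => //; apply: (hv ((gr, sk), 0%N)).
rewrite evalp_varp eqxx /= => /(_ _)/C2_of_eq0[] => [x|_ /eqP].
  by case: ifP => [/eqP->|_]; [exact: homog_C2_of01 | exact: homog0].
by rewrite oner_eq0.
Qed.

End C2Variety.

(** * Partitions and characters of symmetric groups on at most one point *)

Section DegreeAtMostOne.
Variables (n : nat) (n_le1 : (n <= 1)%N).

Lemma perm_le1 (p : 'S_n) : p = 1%g.
Proof.
apply/permP => k; apply/val_inj.
have small (l : 'I_n) : val l = 0%N.
  by apply/eqP; rewrite -leqn0 -ltnS (leq_trans (ltn_ord l)).
by rewrite !small.
Qed.

Lemma partn_le1 (la mu : partn n) : la = mu.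
Proof.
(* [nseq n n] is empty for [n = 0] and [[:: 1]] for [n = 1]. *)
have partsE (nu : partn n) : parts nu = nseq n n.
  have /andP[_ /eqP] := valP nu.
  have : size (parts nu) = n by rewrite size_map size_tuple.
  rewrite -/(parts nu); case: (n) n_le1 (parts nu) => [|[]] // _.
    by case.
  by case=> [|x []] //= _; rewrite addn0 => ->.
apply/val_inj/val_inj/(inj_map val_inj).
by rewrite -/(parts la) partsE -(partsE mu).
Qed.

(** The group is trivial, so its group algebra is a line. The Young symmetrizer is nonzero, having
    coefficient 1 at the identity, and generates the whole line; the trace of the identity on it is
    1. *)
Lemma irr_char_le1 (F : fieldType) (la : partn n) (g : 'S_n) :
  irr_char F la g = 1.
Proof.
rewrite /irr_char (perm_le1 g) repr_mx1 mxtrace1.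
have card1 : #|[set: 'S_n]%G| = 1%N.
  by rewrite (_ : [set: 'S_n]%G = 1%G) ?cards1 //; apply/val_inj/setP => p;
    rewrite !inE (perm_le1 p) eqxx.
suff -> : \rank (cyclic_mx (regular_repr F [set: 'S_n]%G) (young_sym F la))
  = 1%N by [].
apply/eqP; rewrite eqn_leq -{1}card1 rank_leq_col lt0n mxrank_eq0 cyclic_mx_eq0.
rewrite /young_sym.
have rowE : row_stab la = [set 1%g].
  apply/setP => p; rewrite (perm_le1 p) !inE eqxx.
  by apply/forallP => k; rewrite perm1.
have colE : col_stab la = [set 1%g].
  apply/setP => p; rewrite (perm_le1 p) !inE eqxx.
  by apply/forallP => k; rewrite perm1.
rewrite rowE colE !big_set1 odd_perm1 expr0 scale1r.
apply/eqP => /matrixP /(_ 0 (gring_index [set: 'S_n]%G (1 * 1)%g)) /eqP.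
by rewrite !mxE !eqxx oner_eq0.
Qed.

End DegreeAtMostOne.

(** * Proper polynomials and multiplicities in degree one *)

Section DegreeOneMultiplicity.
Variables (F : fieldType) (hF : [pchar F] =i pred0).
Variables (A : algType F) (S : staralg A).
Variables (n1 n2 n3 n4 : nat) (t : vsort).
Hypotheses (n1_le1 : (n1 <= 1)%N) (n2_le1 : (n2 <= 1)%N).
Hypotheses (n3_le1 : (n3 <= 1)%N) (n4_le1 : (n4 <= 1)%N).
(** A single variable, of unspecified sort [t]: the three parts of the theorem become instances of
    one statement. *)
Hypothesis gvars1 : gvars n1 n2 n3 n4 = [:: (t, 0%N)].

Let x0 : freealg F := varp F (t, 0%N).

Lemma perm4_le1 (g : perm4 n1 n2 n3 n4) : g = 1%g.
Proof. by case: g => [[[a b] c] e]; congr (_, _, _, _); apply: perm_le1. Qed.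

Lemma partn4_le1 (la mu : partn4 n1 n2 n3 n4) : la = mu.
Proof.
case: la mu => [[[? ?] ?] ?] [[[? ?] ?] ?].
by congr (_, _, _, _); apply: partn_le1.
Qed.

Lemma act_var_le1 (g : perm4 n1 n2 n3 n4) x :
  act_var g (varp F x) = varp F x.
Proof.
have block1 m n k : block_perm m (1%g : 'S_n) k = k.
  rewrite /block_perm; case: leqP => // le_mk.
  by case: insubP => // i _ vi; rewrite perm1 [val i]vi subnKC.
rewrite /act_var evalp_varp (perm4_le1 g).
by case: x => [[[] []] k]; rewrite /= block1.
Qed.

Lemma Gamma_le1 f : Gamma n1 n2 n3 n4 f -> exists k, f = k *: x0.
Proof.
rewrite /Gamma gvars1 => -[[d [c [x [hx ->]]]] _].
exists (\sum_i c i); rewrite scaler_suml; apply: eq_bigr => i _.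
have [w /perm_small_eq -> // ->] := hx i.
by rewrite big_seq1.
Qed.

(** In a proper product only variables of sort [sort0p] are confined to commutators; a variable of
    any other sort is by itself a proper product. *)
Lemma x0_Gamma : t != sort0p -> Gamma n1 n2 n3 n4 x0.
Proof.
move=> t0; rewrite /Gamma gvars1.
have span1 (X : set (freealg F)) : X x0 -> lin_span X x0.
  move=> Xx; exists 1%N, (fun=> 1), (fun=> x0); split => //.
  by rewrite big_ord1 scale1r.
split; apply: span1; first by exists [:: (t, 0%N)]; rewrite ?big_seq1.
(* The filters put the variable into the list of its own sort and leave the other two empty. *)
exists [seq x <- [:: (t, 0%N)] | x.1 == sort0m].
exists [seq x <- [:: (t, 0%N)] | x.1 == sort1p].
exists [seq x <- [:: (t, 0%N)] | x.1 == sort1m], [::].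
split; rewrite ?filter_all //.
rewrite /x0; case: t t0 => [[] []] //= _;
  by rewrite !big_nil !big_seq1 ?mulr1 ?mul1r.
Qed.

Lemma Idstar_x0 : ~ Idstar S x0 <-> exists2 a, homog S t a & a != 0.
Proof.
split=> [nI|[a ha a0] Ix].
  apply: contrapT => noA; apply: nI => v hv; rewrite evalp_varp.
  apply: contrapT => /eqP v0; apply: noA.
  by exists (v (t, 0%N)) => //; apply: (hv (t, 0%N)).
have := Ix (fun x => if x.1 == t then a else 0).
rewrite evalp_varp eqxx => a_eq0; move/eqP: a0; apply; apply: a_eq0 => x.
by case: ifP => [/eqP->|_]; [exact: ha | exact: homog0].
Qed.

Lemma Idstar_scale k f : Idstar S f -> Idstar S (k *: f).
Proof. by move=> If v hv; rewrite evalpZ If ?scaler0. Qed.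

(** The proper polynomials form the line spanned by [x0], so their quotient by the identities has
    dimension 1 or 0 according to whether [x0] survives. *)
Lemma affords_Gamma_le1 d
    (rG : mx_representation F [set: perm4 n1 n2 n3 n4]%G d) :
  t != sort0p -> affords_Gamma S rG -> d = 1%N <-> ~ Idstar S x0.
Proof.
move=> t0 [s [Gs free_s span_s] _].
have [k sE] := choice (fun i => Gamma_le1 (Gs i)).
have sumE c : \sum_i c i *: s i = (\sum_i c i * k i) *: x0.
  by rewrite scaler_suml; apply: eq_bigr => i _; rewrite sE scalerA.
split=> [d1 Ix|nI].
  have i0 : 'I_d by rewrite d1; exact: ord0.
  have /eqP := oner_neq0 F; apply; apply: (free_s (fun=> 1)) i0.
  by rewrite sumE; exact: Idstar_scale.
apply/eqP; rewrite eqn_leq; apply/andP; split.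
  (* Independence of [s] modulo identities makes the [d] by 1 matrix of the coefficients [k] row
     free, so [d] is its rank, at most 1. *)
  have /eqP <- : row_free (\col_i k i).
    apply: inj_row_free => v /matrixP/(_ 0 0); rewrite !mxE => vk0.
    apply/rowP => i; rewrite mxE; apply: (free_s (v 0)).
    rewrite sumE (_ : \sum_i _ = 0); last first.
      by rewrite -[RHS]vk0; apply: eq_bigr => j _; rewrite mxE.
    by rewrite scale0r => u _; exact: mmap0.
  exact: rank_leq_col.
rewrite lt0n; apply/eqP => d0; apply: nI.
have [c] := span_s _ (x0_Gamma t0).
by rewrite big1 ?subr0 // => i; have := ltn_ord i; rewrite {2}d0.
Qed.

(** There is only one multipartition and its character is 1, so the character equation at the
    identity says that the multiplicity equals the dimension [d]. *)
Lemma proper_mult_le1 (la : partn4 n1 n2 n3 n4) : t != sort0p ->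
  proper_mult S la = 1%N <-> exists2 a, homog S t a & a != 0.
Proof.
move=> t0; rewrite -Idstar_x0.
have mE m : @proper_mults F A S n1 n2 n3 n4 m -> m la = 1%N <-> ~ Idstar S x0.
  move=> [d [rG [/(affords_Gamma_le1 t0) <- /(_ 1%g)]]].
  rewrite repr_mx1 mxtrace1 (bigD1 la) //= big1 => [|mu /eqP[]]; last first.
    exact: partn4_le1.
  rewrite /irr_char4 !irr_char_le1 // !mulr1 addr0.
  by move=> /(natf_inj hF)->.
split=> [|nI].
  (* If no multiplicities existed, the default value would be 0, which is not 1. *)
  rewrite /proper_mult; case: xgetP => [m _ /mE <- //|_]; by rewrite ffunE.
(* Here the default must be excluded: the trivial representation on the line of [x0] realizes
   multiplicity 1. *)
rewrite /proper_mult; case: xgetP => [m _ /mE ->//|/(_ [ffun=> 1%N])[]].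
have triv_repr : mx_repr [set: perm4 n1 n2 n3 n4]%G (fun=> 1%:M : 'M[F]_1).
  by split=> [|g h _ _]; rewrite ?mulmx1.
exists 1%N, (MxRepresentation triv_repr); split; last first.
  move=> g; rewrite mxtrace1 (bigD1 la) //= big1 => [|mu /eqP[]]; last first.
    exact: partn4_le1.
  by rewrite /irr_char4 !irr_char_le1 // ffunE !mulr1 addr0.
exists (fun=> x0); last first.
  move=> g i; rewrite act_var_le1 big_ord1 mxE (ord1 i) eqxx scale1r subrr.
  by move=> v _; exact: mmap0.
split=> [_|c|f /Gamma_le1[k ->]]; first exact: x0_Gamma.
  rewrite big_ord1 => Ic i; rewrite (ord1 i); apply: contrapT => /eqP c0.
  by apply: nI; rewrite -(scalerK c0 x0); exact: Idstar_scale.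
exists (fun=> k); rewrite big_ord1 subrr => v _; exact: mmap0.
Qed.

End DegreeOneMultiplicity.

(** * The equivalences for the three sorts *)

Theorem lemma4p1 (R : realType) (F : fieldType) (hF : [pchar F] =i pred0)
    (A : algType F) (S : staralg A) (hJ : F_plus_J A)
    (hq : quadratic_growth R S) :
  [/\ @proper_mult F A S 0 1 0 0 (partn_nil, partn_one, partn_nil, partn_nil)
        = 1%N <-> in_varstar S (C2_skew F),
      @proper_mult F A S 0 0 1 0 (partn_nil, partn_nil, partn_one, partn_nil)
        = 1%N <-> in_varstar S (C2_gr F)
    & @proper_mult F A S 0 0 0 1 (partn_nil, partn_nil, partn_nil, partn_one)
        = 1%N <-> in_varstar S (C2_gr_skew F)].
Proof.
have in_varstarE gr sk : (gr, sk) != sort0p ->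
    in_varstar S (C2_staralg F gr sk) <->
    exists2 a, homog S (gr, sk) a & a != 0.
  move=> ne; split=> [|[a]]; first exact: in_varstar_C2_homog.
  exact: in_varstar_C2.
split.
- rewrite (@proper_mult_le1 F hF A S 0 1 0 0 sort0m) //.
  exact: iff_sym (in_varstarE false true isT).
- rewrite (@proper_mult_le1 F hF A S 0 0 1 0 sort1p) //.
  exact: iff_sym (in_varstarE true false isT).
- rewrite (@proper_mult_le1 F hF A S 0 0 0 1 sort1m) //.
  exact: iff_sym (in_varstarE true true isT).
Qed.
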